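(* Let $p \neq 2$ be a prime and let $e \ge 1$ be an integer. Let $c \in \mathbb{Z}_p^\times$ be fixed and let $m$ be the multiplicative order of $c$ modulo $p$. Then the number of solutions to the congruence $$x^x \equiv c \pmod{p^e}$$ with $x \in \{1, 2, \ldots, p^e(p-1)\}$ and $p \nmid x$ is given by the formula $$\sum_{\substack{0 \le x_0 \le p-2 \\ \gcd(x_0, p-1) \mid \frac{p-1}{m}}} \gcd(x_0, p-1) = \sum_{d \mid \frac{p-1}{m}} d\, \phi\left(\frac{p-1}{d}\right).$$
   Context: $\mathbb{Z}_p$ denotes the ring of $p$-adic integers, $\phi$ is Euler's totient function, and $\gcd(0, p-1) = p-1$. *)

(* Defs.v *)
From HB Require Import structures.
From mathcomp Require Import all_boot all_order all_algebra.
From mathcomp Require Import boolp.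

Set Implicit Arguments.
Unset Strict Implicit.
Unset Printing Implicit Defensive.

Import GRing.Theory.
Local Open Scope ring_scope.

(* Z_p as the inverse limit of the rings Z/p^(n+1), n >= 0, along the
   reduction maps, with componentwise operations.  The indices start at p^1
   because 'Z_1 is not the zero ring.  As for 'Z_p and 'F_p, the type makes
   sense for every p : nat, but is only meaningful for p > 1. *)

Definition padic_red (p n : nat) (a : 'Z_(p ^ n.+2)) : 'Z_(p ^ n.+1) :=
  (a : nat)%:R.

Record padic (p : nat) : Type := Padic {
  padic_res :> forall n : nat, 'Z_(p ^ n.+1);
  padic_coherent : forall n, padic_red (padic_res n.+1) = padic_res n }.

Section PadicRing.
Variable p : nat.

Lemma padic_modulus_dvd (n : nat) :
  ((Zp_trunc (p ^ n.+1)).+2 %| (Zp_trunc (p ^ n.+2)).+2)%N.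
Proof.
case: p => [|[|q]]; first by rewrite !exp0n.
  by rewrite !exp1n.
have lt1 k : (1 < q.+2 ^ k.+1)%N by rewrite -{1}(expn0 q.+2) ltn_exp2l.
by rewrite !Zp_cast ?lt1 // dvdn_exp2l.
Qed.

Lemma padic_red_nat (n i : nat) : @padic_red p n i%:R = i%:R.
Proof.
rewrite /padic_red !Zp_nat; apply: val_inj => /=.
by rewrite modn_dvdm // padic_modulus_dvd.
Qed.

Lemma padic_redD (n : nat) : {morph @padic_red p n : a b / a + b}.
Proof.
by move=> a b; rewrite -[a]natr_Zp -[b]natr_Zp -natrD !padic_red_nat natrD.
Qed.

Lemma padic_redM (n : nat) : {morph @padic_red p n : a b / a * b}.
Proof.
by move=> a b; rewrite -[a]natr_Zp -[b]natr_Zp -natrM !padic_red_nat natrM.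
Qed.

Lemma padic_red0 (n : nat) : @padic_red p n 0 = 0.
Proof. exact: (padic_red_nat n 0). Qed.

Lemma padic_red1 (n : nat) : @padic_red p n 1 = 1.
Proof. exact: (padic_red_nat n 1). Qed.

Lemma padic_redN (n : nat) : {morph @padic_red p n : a / - a}.
Proof.
by move=> a; apply/eqP; rewrite -addr_eq0 -padic_redD addNr padic_red0.
Qed.

Lemma padicP (x y : padic p) : (forall n, x n = y n) -> x = y.
Proof.
case: x y => [f cf] [g cg] /= fg.
have {}fg : f = g by apply: functional_extensionality_dep.
by case: _ / fg cg => cg; congr Padic; apply: Prop_irrelevance.
Qed.

HB.instance Definition _ := gen_eqMixin (padic p).
HB.instance Definition _ := gen_choiceMixin (padic p).

Definition padic_zero : padic p :=
  @Padic p (fun=> 0) (fun n => padic_red0 n).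

Definition padic_one : padic p :=
  @Padic p (fun=> 1) (fun n => padic_red1 n).

Lemma padic_opp_subproof (x : padic p) n : padic_red (- x n.+1) = - x n.
Proof. by rewrite padic_redN padic_coherent. Qed.

Definition padic_opp (x : padic p) : padic p :=
  @Padic p (fun n => - x n) (padic_opp_subproof x).

Lemma padic_add_subproof (x y : padic p) n :
  padic_red (x n.+1 + y n.+1) = x n + y n.
Proof. by rewrite padic_redD !padic_coherent. Qed.

Definition padic_add (x y : padic p) : padic p :=
  @Padic p (fun n => x n + y n) (padic_add_subproof x y).

Lemma padic_mul_subproof (x y : padic p) n :
  padic_red (x n.+1 * y n.+1) = x n * y n.
Proof. by rewrite padic_redM !padic_coherent. Qed.

Definition padic_mul (x y : padic p) : padic p :=
  @Padic p (fun n => x n * y n) (padic_mul_subproof x y).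

Lemma padic_addA : associative padic_add.
Proof. by move=> x y z; apply: padicP => n /=; rewrite addrA. Qed.
Lemma padic_addC : commutative padic_add.
Proof. by move=> x y; apply: padicP => n /=; rewrite addrC. Qed.
Lemma padic_add0 : left_id padic_zero padic_add.
Proof. by move=> x; apply: padicP => n /=; rewrite add0r. Qed.
Lemma padic_addN : left_inverse padic_zero padic_opp padic_add.
Proof. by move=> x; apply: padicP => n /=; rewrite addNr. Qed.

HB.instance Definition _ := GRing.isZmodule.Build (padic p)
  padic_addA padic_addC padic_add0 padic_addN.

Lemma padic_mulA : associative padic_mul.
Proof. by move=> x y z; apply: padicP => n /=; rewrite mulrA. Qed.
Lemma padic_mulC : commutative padic_mul.
Proof. by move=> x y; apply: padicP => n /=; rewrite mulrC. Qed.
Lemma padic_mul1 : left_id padic_one padic_mul.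
Proof. by move=> x; apply: padicP => n /=; rewrite mul1r. Qed.
Lemma padic_mulDl : left_distributive padic_mul padic_add.
Proof. by move=> x y z; apply: padicP => n /=; rewrite mulrDl. Qed.
Lemma padic_one_neq0 : padic_one != padic_zero.
Proof.
apply/eqP => /(congr1 (fun x : padic p => padic_res x 0)) /= /eqP.
by rewrite oner_eq0.
Qed.

HB.instance Definition _ := GRing.Zmodule_isComNzRing.Build (padic p)
  padic_mulA padic_mulC padic_mul1 padic_mulDl padic_one_neq0.

Definition padic_unit : {pred padic p} := fun x => `[< exists y, y * x = 1 >].

Definition padic_inv (x : padic p) : padic p :=
  if pselect (exists y, y * x = 1) is left ex then projT1 (cid ex) else x.

Lemma padic_mulV : {in padic_unit, left_inverse 1 padic_inv *%R}.
Proof.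
move=> x /asboolP ux; rewrite /padic_inv; case: pselect => // ex.
exact: projT2 (cid ex).
Qed.

Lemma padic_unitPl (x y : padic p) : y * x = 1 -> padic_unit x.
Proof. by move=> yx; apply/asboolP; exists y. Qed.

Lemma padic_inv_out : {in [predC padic_unit], padic_inv =1 id}.
Proof.
by move=> x /asboolP nux; rewrite /padic_inv; case: pselect.
Qed.

HB.instance Definition _ := GRing.ComNzRing_hasMulInverse.Build (padic p)
  padic_mulV padic_unitPl padic_inv_out.

End PadicRing.

(* a = b mod p^e Z_p *)
Definition padic_eqmod (p e : nat) (a b : padic p) : Prop :=
  exists z : padic p, a - b = (p ^ e)%:R * z.

Definition padic_order_mod (p : nat) (c : padic p) (m : nat) : Prop :=
  [/\ (0 < m)%N, padic_eqmod 1 (c ^+ m) 1 &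
      forall k : nat, (0 < k)%N -> padic_eqmod 1 (c ^+ k) 1 -> (m <= k)%N].

Definition selfpower_solutions (p e : nat) (c : padic p) :
    {set 'I_(p ^ e * (p - 1)).+1} :=
  [set x : 'I_(p ^ e * (p - 1)).+1 |
    [&& (1 <= x)%N, ~~ (p %| x)%N & `[< padic_eqmod e (x%:R ^+ x) c >]]].

(* Main.v *)
Require Import Defs.
From mathcomp Require Import all_boot all_order all_algebra.
From mathcomp Require Import all_fingroup all_solvable all_field.
From mathcomp Require Import boolp.
From mathcomp Require Import zify.

(** Fix the target residue b of c modulo p ^ e.  On integers prime to p the
    value of x ^ x modulo p ^ k.+1 depends on x modulo p ^ k.+1 * (p - 1) only,
    and the count reduces to e = 1 by a Hensel argument for x ^ x.

    Suppose y = x + d with p ^ k.+1 * (p - 1) dividing d.  Modulo p ^ k.+2,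
    Euler's theorem gives y ^ y = y ^ x, and the binomial expansion gives
    y ^ x = x ^ x + x ^ x * d, because the coefficient x of x ^ (x - 1) * d
    restores the missing factor.  So x ^ x is as sensitive to x as x itself:
    within a class modulo p * (p - 1), the value of x ^ x modulo p ^ k.+1
    determines x modulo p ^ k.+1 * (p - 1) ([selfpower_inj]).  Such a class has
    p ^ k members, and their values lie among the p ^ k residues with one given
    reduction modulo p; by the pigeonhole principle each of these residues is
    attained ([selfpower_lift]).  Hence every solution modulo p lifts to exactly
    one solution modulo p ^ e ([card_selfpower_lift]).

    Modulo p, the base x modulo p and the exponent x0 = x modulo p - 1 are
    independent by the Chinese remainder theorem, so one counts the nonzero
    v in F_p with v ^ x0 = b for each x0 ([card_selfpower_modp]).  The units of
    F_p form a cyclic group of order p - 1, so with g = gcd(x0, p - 1) there are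
    g such v if b ^ ((p - 1) / g) = 1, and none otherwise ([card_expf_fiber]).
    As b has order m, the condition reads m | (p - 1) / g, or equivalently
    g | (p - 1) / m.  This is the first sum.  The second one groups its terms by
    the value d of the gcd, which is taken totient ((p - 1) / d) times
    ([sum_gcdn_dvd]). *)

Set Implicit Arguments.
Unset Strict Implicit.

(** * Sums over gcds *)

(** The x in question are the d * y with y < n / d prime to n / d. *)
Lemma card_gcdn_eq (n d : nat) : 0 < n -> d %| n ->
  \sum_(0 <= x < n | gcdn x n == d) 1 = totient (n %/ d).
Proof.
move=> n_gt0 /dvdnP[k def_n]; move: n_gt0; rewrite {}def_n => kd_gt0.
have [k_gt0 d_gt0] : 0 < k /\ 0 < d by apply/andP; rewrite -muln_gt0.
rewrite mulnK // totient_count_coprime -[LHS]big_filter -[in RHS]big_mkcond.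
rewrite -[RHS]big_filter -[RHS](big_map (muln^~ d) predT (fun=> 1)).
apply/perm_big/uniq_perm.
- exact/filter_uniq/iota_uniq.
- rewrite map_inj_uniq; first exact/filter_uniq/iota_uniq.
  by move=> x y /eqP; rewrite eqn_pmul2r // => /eqP.
move=> x; rewrite mem_filter mem_index_iota /=; apply/idP/mapP.
- case/andP=> /eqP gx ltx; have: d %| x by rewrite -gx dvdn_gcdl.
  case/dvdnP=> y def_x; exists y => //; move: gx ltx.
  rewrite def_x mem_filter mem_index_iota -muln_gcdl ltn_pmul2r //= => gy ->.
  by rewrite andbT coprime_sym /coprime -(eqn_pmul2r d_gt0) gy mul1n.
case=> y; rewrite mem_filter mem_index_iota /= => /andP[co_y lty] ->.
by rewrite -muln_gcdl ltn_pmul2r // lty andbT gcdnC (eqP co_y) mul1n.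
Qed.

Lemma sum_gcdn_dvd (n k : nat) : 0 < n -> k %| n ->
  \sum_(0 <= x < n | gcdn x n %| k) gcdn x n =
  \sum_(d <- divisors k) d * totient (n %/ d).
Proof.
move=> n_gt0 k_dvd; have k_gt0 := dvdn_gt0 n_gt0 k_dvd.
(* Spread each term over its gcd d, so that the sums can be exchanged. *)
have gcd_split x : \sum_(d <- divisors k | gcdn x n == d) d =
    if gcdn x n %| k then gcdn x n else 0.
  rewrite (eq_bigl (eq_op^~ (gcdn x n))) => [|d]; last exact: eq_sym.
  rewrite dvdn_divisors //; case: ifP => [in_k | nin_k].
    by rewrite -big_filter filter_pred1_uniq ?divisors_uniq // big_seq1.
  rewrite big_seq_cond big1 // => d /andP[+ /eqP def_d].
  by rewrite def_d nin_k.
rewrite big_mkcond -(eq_bigr _ (fun x _ => gcd_split x)).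
rewrite (exchange_big_dep xpredT) //= big_seq [RHS]big_seq.
apply: eq_bigr => d; rewrite -dvdn_divisors // => d_k.
by rewrite -card_gcdn_eq ?(dvdn_trans d_k) // big_distrr /= muln1.
Qed.

(** * Power maps on cyclic groups and finite fields *)

(** In a cyclic group, membership in a subgroup is divisibility of orders.  The
    kernel of the k-th power map is thus the subgroup of order g, where g is
    the gcd of k and the order of G, and its image is the subgroup of index g,
    which consists of the b with b ^ (#|G| / g) = 1.  A nonempty fiber is a
    coset of the kernel. *)
Lemma card_expg_fiber (gT : finGroupType) (G : {group gT}) (b : gT) (k : nat) :
  cyclic G -> b \in G ->
  #|[set u in G | (u ^+ k == b)%g]| =
    if (b ^+ (#|G| %/ gcdn k #|G|) == 1)%g then gcdn k #|G| else 0.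
Proof.
move=> cycG Gb; have /cyclicP[a defG] := cycG.
have Ga : a \in G by rewrite defG cycle_id.
set n := #|G|; set g := gcdn k n.
have oa : #[a]%g = n by rewrite /n defG.
have n_gt0 : 0 < n by apply: cardG_gt0.
have g_n : g %| n by apply: dvdn_gcdr.
have g_gt0 : 0 < g := dvdn_gt0 n_gt0 g_n.
have oag : #[(a ^+ (n %/ g))%g]%g = g.
  by rewrite orderXdiv oa ?dvdn_div // divnA // mulKn.
have ker_k : #|[set u in G | (u ^+ k == 1)%g]| = g.
  rewrite -[RHS]oag orderE; apply: eq_card => u; rewrite inE -[RHS]cycle_subG.
  have [Gu | nGu] /= := boolP (u \in G); last first.
    apply/esym/negbTE; apply: contra nGu => su.
    by rewrite -cycle_subG (subset_trans su) // cycle_subG groupX.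
  rewrite -(cardSg_cyclic cycG) ?cycle_subG ?groupX // -!orderE oag.
  by rewrite -order_dvdn dvdn_gcd order_dvdG // andbT.
have ab u v : u \in G -> v \in G -> commute u v.
  by move/(centsP (cyclic_abelian cycG)); apply.
have [/eqP bn1 | bn1] := ifP; last first.
  apply: eq_card0 => u; rewrite inE; apply: contraFF bn1 => /andP[Gu /eqP <-].
  rewrite -expgM -order_dvdn (dvdn_trans (order_dvdG Gu)) //.
  by rewrite muln_divCA ?dvdn_gcdl // dvdn_mulr.
have /cycleP[i def_b] : b \in <[(a ^+ k)%g]>%g.
  rewrite -cycle_subG -(cardSg_cyclic cycG) ?cycle_subG ?groupX // -!orderE.
  by rewrite orderXgcd oa gcdnC order_dvdn bn1.
rewrite -ker_k -[RHS](card_imset _ (mulgI (a ^+ i)%g)); apply: eq_card => u.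
have aik : ((a ^+ i) ^+ k = b)%g by rewrite def_b -!expgM mulnC.
apply/idP/imsetP => [|[v]]; rewrite !inE.
  case/andP=> Gu /eqP uk; exists ((a ^+ i)^-1 * u)%g; last by rewrite mulKVg.
  rewrite inE groupM ?groupV ?groupX //= expgMn; last first.
    by apply: ab; rewrite ?groupV ?groupX.
  by rewrite expVgn aik uk mulVg.
case/andP=> Gv /eqP vk ->; rewrite groupM ?groupX //= expgMn; last first.
  by apply: ab; rewrite ?groupX.
by rewrite aik vk mulg1.
Qed.

Section FieldPowers.
Import GRing.Theory.
Local Open Scope ring_scope.

Lemma card_expf_fiber (F : finFieldType) (b : F) (k : nat) : b != 0 ->
  #|[set v : F | (v != 0) && (v ^+ k == b)]| =
    if b ^+ (#|F|.-1 %/ gcdn k #|F|.-1) == 1 then gcdn k #|F|.-1 else 0%N.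
Proof.
move=> b_neq0; have ub : b \is a GRing.unit by rewrite unitfE.
pose B := FinRing.unit F ub.
have := @card_expg_fiber _ [group of [set: {unit F}]] B k
  (field_unit_group_cyclic _) (in_setT _).
rewrite /= card_finField_unit -(inj_eq val_inj) FinRing.val_unitX /= => <-.
rewrite -[RHS](card_imset _ (@val_inj _ _ {unit F})).
apply: eq_card => v; rewrite inE; apply/andP/imsetP => [[v0 /eqP vk]|[u]].
  have uv : v \is a GRing.unit by rewrite unitfE.
  exists (FinRing.unit F uv) => //; rewrite !inE -(inj_eq val_inj).
  by rewrite FinRing.val_unitX /= vk.
rewrite !inE -(inj_eq val_inj) FinRing.val_unitX /= => /eqP uk ->.
by rewrite uk -unitfE (valP u).
Qed.

Lemma expf_card_pred (F : finFieldType) (v : F) : v != 0 -> v ^+ #|F|.-1 = 1.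
Proof.
move=> v0; apply: (mulfI v0); rewrite mulr1 -exprS prednK ?expf_card //.
by apply/card_gt0P; exists 0.
Qed.

End FieldPowers.

(** * The self-power map modulo prime powers *)

Lemma expnD_modsq (x d n : nat) :
  exists q, (x + d) ^ n = x ^ n + n * x ^ n.-1 * d + q * d ^ 2.
Proof.
elim: n => [|n [q IHn]]; first by exists 0; rewrite !mul0n.
exists (n * x ^ n.-1 + q * (x + d)).
have -> : n.+1 * x ^ n.+1.-1 * d = x ^ n * d + n * x ^ n.-1 * d * x.
  case: n {IHn} => [|n] /=; first by rewrite !mul0n mul1n addn0.
  by rewrite expnS; lia.
by rewrite !expnS IHn; nia.
Qed.

Lemma expn_eqmod_totient (N x i j : nat) : coprime x N ->
  i = j %[mod totient N] -> x ^ i = x ^ j %[mod N].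
Proof.
move=> co_xN eq_ij.
suff red k : x ^ k = x ^ (k %% totient N) %[mod N] by rewrite red eq_ij -red.
rewrite {1}(divn_eq k (totient N)) addnC expnD (mulnC (_ %/ _)) expnM -modnMmr.
by rewrite -modnXm Euler_exp_totient // modnXm exp1n modnMmr muln1.
Qed.

Lemma totient_primeX (p k : nat) : prime p ->
  totient (p ^ k.+1) = p ^ k * (p - 1).
Proof. by move=> p_pr; rewrite totient_pfactor // subn1 mulnC. Qed.

Lemma selfpower_eqmod (p k x y : nat) : prime p -> ~~ (p %| x) ->
  x = y %[mod p ^ k.+1 * (p - 1)] -> x ^ x = y ^ y %[mod p ^ k.+1].
Proof.
move=> p_pr npx eq_xy.
have eq_xy_pk : x = y %[mod p ^ k.+1].
  rewrite -(@modn_dvdm _ x _ (dvdn_mulr (p - 1) (dvdnn _))) eq_xy.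
  by rewrite modn_dvdm ?dvdn_mulr.
rewrite -[in RHS]modnXm -eq_xy_pk modnXm; apply: expn_eqmod_totient.
  by rewrite coprimeXr // coprime_sym prime_coprime.
have dv : totient (p ^ k.+1) %| p ^ k.+1 * (p - 1).
  by rewrite totient_primeX // expnSr mulnAC dvdn_mulr.
by rewrite -(modn_dvdm x dv) eq_xy modn_dvdm.
Qed.

(** The derivative argument: with d = y - x, the difference y ^ y - x ^ x is
    x ^ x * d modulo p ^ k.+2, and x ^ x is a unit. *)
Lemma selfpower_eqmod_step (p k x y : nat) : prime p -> ~~ (p %| x) ->
  x = y %[mod p ^ k.+1 * (p - 1)] ->
  x ^ x = y ^ y %[mod p ^ k.+2] -> x = y %[mod p ^ k.+2].
Proof.
move=> p_pr npx eq_xy; have p_dv z : p %| p ^ k.+1 * z.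
  by rewrite expnS -mulnA dvdn_mulr.
have npy : ~~ (p %| y).
  by rewrite /dvdn -(modn_dvdm y (p_dv (p - 1))) -eq_xy modn_dvdm // -/(dvdn p x).
wlog le_xy : x y npx npy eq_xy / x <= y.
  move=> W; case/orP: (leq_total x y) => [|le_yx]; first exact: W.
  by move=> eq_pow; apply/esym/W.
set d := y - x; have def_y : y = x + d by rewrite subnKC.
have dvd_d : p ^ k.+1 * (p - 1) %| d.
  by rewrite -eqn_mod_dvd //; apply/eqP.
have pk_d : p ^ k.+1 %| d := dvdn_trans (dvdn_mulr _ (dvdnn _)) dvd_d.
(* The totient of p ^ k.+2 is p ^ k.+1 * (p - 1), which divides y - x. *)
have -> : y ^ y = y ^ x %[mod p ^ k.+2].
  apply: expn_eqmod_totient; last by rewrite totient_primeX.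
  by rewrite coprimeXr // coprime_sym prime_coprime.
(* The remainder is a multiple of d ^ 2, hence of p ^ (2 * k.+1). *)
have [q ->] : exists q, y ^ x = x ^ x + x * x ^ x.-1 * d + q * d ^ 2.
  by rewrite def_y; apply: expnD_modsq.
have x_gt0 : 0 < x by case: x npx {le_xy eq_xy d def_y dvd_d pk_d q} => //; rewrite dvdn0.
rewrite -expnS prednK // -addnA => /esym/eqP.
rewrite eqn_mod_dvd ?leq_addr // addKn dvdn_addl; last first.
  rewrite dvdn_mull // (dvdn_trans _ (dvdn_exp2r 2 pk_d)) // -expnM.
  by rewrite dvdn_exp2l // muln2 -addnn; lia.
rewrite Gauss_dvdr; last by rewrite coprimeXl // coprimeXr // prime_coprime.
by rewrite /d -eqn_mod_dvd // => /eqP.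
Qed.

Lemma coprime_primeX_pred (p k : nat) : prime p -> coprime (p ^ k) (p - 1).
Proof.
move=> p_pr; rewrite coprimeXl // coprime_sym subn1.
by rewrite -{2}(prednK (prime_gt0 p_pr)) coprimenS.
Qed.

(** Induction on k; the congruence modulo p - 1 is known from the start, so that
    each step only gains one more factor p. *)
Lemma selfpower_inj (p k x y : nat) : prime p -> ~~ (p %| x) ->
  x = y %[mod p * (p - 1)] -> x ^ x = y ^ y %[mod p ^ k.+1] ->
  x = y %[mod p ^ k.+1 * (p - 1)].
Proof.
move=> p_pr npx; elim: k => [|k IHk] eq_xy eq_pow; first by rewrite expn1.
have eq_xy_k : x = y %[mod p ^ k.+1 * (p - 1)].
  apply: IHk => //; rewrite -(modn_dvdm _ (dvdn_exp2l p (leqnSn k.+1))).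
  by rewrite eq_pow modn_dvdm // dvdn_exp2l.
apply/eqP; rewrite chinese_remainder ?coprime_primeX_pred //; apply/andP; split.
  by apply/eqP; apply: selfpower_eqmod_step eq_xy_k eq_pow.
have dv : p - 1 %| p * (p - 1) by apply: dvdn_mull.
by rewrite -(modn_dvdm x dv) eq_xy modn_dvdm.
Qed.

(** Injectivity forces surjectivity: the p ^ k candidates x = r + j * p * (p - 1)
    have self-powers that agree modulo p and differ modulo p ^ k.+1.  Reduced
    modulo p ^ k.+1 and divided by p, these self-powers therefore run through
    all of 0, .., p ^ k - 1, and one of them gives the same quotient as b. *)
Lemma selfpower_lift (p k r b : nat) : prime p -> ~~ (p %| r) ->
  r ^ r = b %[mod p] ->
  exists2 x, x = r %[mod p * (p - 1)] & x ^ x = b %[mod p ^ k.+1].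
Proof.
move=> p_pr npr eq_rb; have p_gt0 := prime_gt0 p_pr.
pose x (j : 'I_(p ^ k)) := r + j * (p * (p - 1)).
have x_r j : x j = r %[mod p * (p - 1)] by rewrite /x addnC modnMDl.
have p_dv : p %| p ^ k.+1 by rewrite expnS dvdn_mulr.
have npx j : ~~ (p %| x j) by rewrite /x dvdn_addl // mulnCA dvdn_mulr.
have digitP y : y %% p ^ k.+1 %/ p < p ^ k.
  by rewrite ltn_divLR // -expnSr ltn_mod expn_gt0 p_gt0.
pose digit y : 'I_(p ^ k) := Ordinal (digitP y).
have digit_inj y z : y = z %[mod p] -> digit y = digit z -> y = z %[mod p ^ k.+1].
  move=> eq_yz /(congr1 val) /= eq_d.
  rewrite (divn_eq (y %% _) p) eq_d [RHS](divn_eq (z %% _) p).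
  by rewrite !modn_dvdm // eq_yz.
have powp j : x j ^ x j = b %[mod p].
  rewrite -eq_rb; have := @selfpower_eqmod p 0 (x j) r p_pr (npx j).
  by rewrite !expn1; apply.
have inj : injective (fun j => digit (x j ^ x j)).
  move=> i j /digit_inj eq_ij; apply: val_inj => /=.
  have /(selfpower_inj p_pr (npx i)) : x i ^ x i = x j ^ x j %[mod p ^ k.+1].
    by apply: eq_ij; rewrite !powp.
  rewrite !x_r => /(_ erefl)/eqP.
  rewrite /x eqn_modDl expnSr -mulnA -!muln_modl eqn_pmul2r; last first.
    by rewrite muln_gt0 p_gt0 subn_gt0 prime_gt1.
  by rewrite !modn_small // => /eqP.
have /codomP[j def_b] := injF_onto inj (digit b).
by exists (x j); rewrite ?x_r //; apply: digit_inj.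
Qed.

(** Reduction modulo p * (p - 1) is a bijection between the two sets. *)
Lemma card_selfpower_lift (p k b : nat) : prime p ->
  #|[set x : 'I_(p ^ k.+1 * (p - 1)) |
      ~~ (p %| x) && (x ^ x == b %[mod p ^ k.+1])]| =
  #|[set x : 'I_(p * (p - 1)) | ~~ (p %| x) && (x ^ x == b %[mod p])]|.
Proof.
move=> p_pr; have p_gt0 := prime_gt0 p_pr.
have n_gt0 : 0 < p - 1 by rewrite subn_gt0 prime_gt1.
have N_gt0 : 0 < p * (p - 1) by rewrite muln_gt0 p_gt0.
have Nk_gt0 : 0 < p ^ k.+1 * (p - 1) by rewrite muln_gt0 expn_gt0 p_gt0.
have N_dv : p * (p - 1) %| p ^ k.+1 * (p - 1).
  by rewrite dvdn_mul // expnS dvdn_mulr.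
have p_N : p %| p * (p - 1) by apply: dvdn_mulr.
have dvdp x y : x = y %[mod p * (p - 1)] -> (p %| x) = (p %| y).
  by move=> eq_xy; rewrite /dvdn -(modn_dvdm x p_N) eq_xy modn_dvdm.
have powp x y : ~~ (p %| x) -> x = y %[mod p * (p - 1)] ->
    x ^ x = y ^ y %[mod p].
  by move=> npx; have := @selfpower_eqmod p 0 x y p_pr npx; rewrite !expn1.
pose h (x : 'I_(p ^ k.+1 * (p - 1))) := Ordinal (ltn_pmod x N_gt0).
have hE x : h x = x %[mod p * (p - 1)] by rewrite /= modn_mod.
rewrite -(@card_in_imset _ _ h); last first.
  move=> x y; rewrite !inE => /andP[npx /eqP xb] /andP[_ /eqP yb].
  move/(congr1 val) => /= eq_xy; apply: val_inj => /=.
  have := selfpower_inj p_pr npx eq_xy (etrans xb (esym yb)).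
  by rewrite !modn_small.
apply: eq_card => r; apply/imsetP/idP => [[x]|]; rewrite !inE.
  case/andP=> npx /eqP xb ->; rewrite (dvdp _ _ (hE x)) npx /=.
  have p_pk : p %| p ^ k.+1 by rewrite expnS dvdn_mulr.
  by rewrite -(powp _ _ npx (esym (hE x))) -(modn_dvdm _ p_pk) xb modn_dvdm.
case/andP=> npr /eqP rb.
have [x x_r xb] := selfpower_lift k p_pr npr rb.
have def_x : x %% (p ^ k.+1 * (p - 1)) = x %[mod p * (p - 1)].
  by rewrite modn_dvdm.
have npx : ~~ (p %| x) by rewrite (dvdp _ _ x_r).
exists (Ordinal (ltn_pmod x Nk_gt0)); last first.
  by apply: val_inj; rewrite /= def_x x_r modn_small.
rewrite inE /= (dvdp _ _ def_x) npx -xb; apply/eqP/esym.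
by apply: selfpower_eqmod; rewrite ?modn_mod.
Qed.

(** * Counting self-power solutions modulo p *)

Section PrimeModulus.
Import GRing.Theory.
Local Open Scope ring_scope.

Lemma natr_Fp_eq (p x y : nat) : prime p ->
  (x%:R == y%:R :> 'F_p) = (x == y %[mod p])%N.
Proof. by move=> p_pr; rewrite -(inj_eq val_inj) /= !val_Fp_nat. Qed.

(** The pair (x modulo p - 1, x modulo p) runs through all of its possible
    values, and x ^ x modulo p depends on the exponent modulo p - 1 only. *)
Lemma card_selfpower_modp (p b : nat) : prime p ->
  #|[set x : 'I_(p * (p - 1)) | ~~ (p %| x)%N && (x ^ x == b %[mod p])%N]| =
    (\sum_(x0 < p - 1)
      #|[set v : 'F_p | (v != 0) && (v ^+ x0 == b%:R)]%R|)%N.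
Proof.
move=> p_pr; have p_gt0 := prime_gt0 p_pr.
have n_gt0 : (0 < p - 1)%N by rewrite subn_gt0 prime_gt1.
pose h (x : 'I_(p * (p - 1))) : 'I_(p - 1) * 'F_p :=
  (Ordinal (ltn_pmod x n_gt0), x%:R).
have h_inj : injective h.
  move=> x y [] eq_n /eqP; rewrite natr_Fp_eq // => eq_p; apply: val_inj => /=.
  have co : coprime p (p - 1) by have := coprime_primeX_pred 1 p_pr; rewrite expn1.
  have /eqP : x = y %[mod p * (p - 1)].
    by apply/eqP; rewrite chinese_remainder // eq_p; apply/eqP.
  by rewrite !modn_small // => /eqP.
have h_bij : bijective h.
  by apply: (inj_card_bij h_inj); rewrite card_prod (card_Fp p_pr) !card_ord mulnC.
under eq_bigr => x0 _ do rewrite -sum1dep_card.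
rewrite pair_big_dep /= (reindex h (onW_bij _ h_bij)) /= -sum1dep_card.
apply: eq_bigl => x; rewrite (dvdn_pcharf (pchar_Fp p_pr)).
have [//|x0 /=] := eqVneq (x%:R : 'F_p) 0.
rewrite -natr_Fp_eq // natrX; congr (_ == _).
rewrite {2}(divn_eq x (p - 1)) exprD (mulnC (_ %/ _)%N) exprM.
by have := expf_card_pred x0; rewrite card_Fp // -subn1 => ->; rewrite expr1n mul1r.
Qed.

End PrimeModulus.

(** * Residues of p-adic integers *)

Section PadicResidues.
Import GRing.Theory.
Local Open Scope ring_scope.
Variable p : nat.
Hypothesis p_gt1 : (1 < p)%N.
Implicit Types (x y : padic p) (k n : nat).

Let pX_gt1 k : (1 < p ^ k.+1)%N.
Proof. by rewrite -(expn0 p) ltn_exp2l. Qed.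

Lemma padic_res_nat n k : (n%:R : padic p) k = n%:R.
Proof. by elim: n => // n IHn; rewrite !mulrS -IHn. Qed.

Lemma padic_resX x n k : (x ^+ n) k = x k ^+ n.
Proof. by elim: n => // n IHn; rewrite !exprS -IHn. Qed.

Lemma padic_res_mod x k n : x k = (x (k + n)%N %% p ^ k.+1)%N :> nat.
Proof.
elim: n => [|n IHn].
  by rewrite addn0 modn_small // -[X in (_ < X)%N](Zp_cast (pX_gt1 k)).
rewrite IHn -(padic_coherent x (k + n)) /padic_red val_Zp_nat // addnS.
by rewrite modn_dvdm // dvdn_exp2l // ltnS leq_addr.
Qed.

(** The residue of the quotient at level n is read off from the residue of x at
    level n + k.+1, since dividing by p ^ k.+1 costs that many digits. *)
Lemma padic_res_dvd x k : x k = 0 -> exists z, x = (p ^ k.+1)%:R * z.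
Proof.
move=> xk0; pose q := (p ^ k.+1)%N.
have q_gt0 : (0 < q)%N by rewrite expn_gt0 (ltnW p_gt1).
have q_x n : (q %| x (n + k.+1))%N.
  by rewrite /dvdn -addSnnS addnC -padic_res_mod xk0.
pose zr n : 'Z_(p ^ n.+1) := ((x (n + k.+1)%N : nat) %/ q)%:R.
have zr_coh n : @padic_red p n (zr n.+1) = zr n.
  rewrite /zr padic_red_nat; apply: val_inj; rewrite /= !val_Zp_nat //.
  have xn : x (n + k.+1)%N = (x (n.+1 + k.+1)%N %% (p ^ n.+1 * q))%N :> nat.
    by rewrite (padic_res_mod x (n + k.+1) 1) addn1 addSn -expnD addSn.
  by rewrite xn -modn_divl modn_mod.
exists (@Padic p zr zr_coh); apply: padicP => n.
have -> : ((p ^ k.+1)%:R * @Padic p zr zr_coh) n = (p ^ k.+1)%:R * zr n.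
  by rewrite -padic_res_nat.
apply: val_inj; rewrite /zr -natrM /= val_Zp_nat // mulnC divnK //.
exact: padic_res_mod.
Qed.

Lemma padic_eqmodP k x y : padic_eqmod k.+1 x y <-> x k = y k.
Proof.
split=> [[z def_z] | eq_xy].
  have : (x - y) k = 0.
    rewrite def_z -[LHS]/(((p ^ k.+1)%:R : padic p) k * z k) padic_res_nat.
    by rewrite pchar_Zp // mul0r.
  by move/eqP; rewrite -[(x - y) k]/(x k - y k) subr_eq0 => /eqP.
by apply: padic_res_dvd; rewrite -[LHS]/(x k - y k) eq_xy subrr.
Qed.

Lemma padic_eqmod_nat k x n (b : nat) : x k = b%:R ->
  padic_eqmod k.+1 n%:R x <-> n = b %[mod p ^ k.+1].
Proof.
move=> def_b; rewrite padic_eqmodP padic_res_nat def_b.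
split=> [/(congr1 val) | eq_nb]; first by rewrite /= !val_Zp_nat.
by apply: val_inj; rewrite /= !val_Zp_nat.
Qed.

Lemma padic_eqmod1_Fp (p_pr : prime p) x (b : nat) : x 0%N = b%:R ->
  padic_eqmod 1 x 1 <-> b%:R = 1 :> 'F_p.
Proof.
move=> def_b; rewrite padic_eqmodP def_b -[(1 : padic p) 0%N]/(1%:R).
have eq1 : (b%:R == 1 :> 'F_p) = (b == 1 %[mod p])%N := natr_Fp_eq b 1 p_pr.
split=> [/(congr1 (@nat_of_ord _)) | /eqP].
  rewrite !val_Zp_nat // expn1.
  by move/eqP; rewrite -eq1 => /eqP.
by rewrite eq1 => /eqP e1; apply: ord_inj; rewrite !val_Zp_nat // expn1.
Qed.

End PadicResidues.

Lemma padic_order_primitive (p : nat) (c : padic p) (m b : nat) : prime p ->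
  (c 0%N = b%:R)%R -> padic_order_mod c m -> (m.-primitive_root (b%:R : 'F_p))%R.
Proof.
move=> p_pr def_b [m_gt0 cm1 m_min].
have eqm k : padic_eqmod 1 (c ^+ k)%R 1%R <-> (b%:R ^+ k = 1 :> 'F_p)%R.
  rewrite -GRing.natrX; apply: padic_eqmod1_Fp => //; first exact: prime_gt1.
  by rewrite padic_resX def_b GRing.natrX.
apply/andP; split=> //; apply/forallP=> i; rewrite unity_rootE.
apply/eqP; apply/eqP/eqP => [/eqm bi | ->]; last exact/eqm.
by apply/eqP; rewrite eqn_leq ltn_ord m_min.
Qed.

(** * The number of solutions *)

Theorem corollary17 (p : nat) (p_prime : prime p) (p_neq2 : p <> 2)
    (e : nat) (e_ge1 : 1 <= e)
    (c : padic p) (c_unit : c \is a GRing.unit)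
    (m : nat) (m_order : padic_order_mod c m) :
  #|selfpower_solutions e c| =
    \sum_(0 <= x0 < p - 1 | gcdn x0 (p - 1) %| (p - 1) %/ m) gcdn x0 (p - 1)
  /\
  \sum_(0 <= x0 < p - 1 | gcdn x0 (p - 1) %| (p - 1) %/ m) gcdn x0 (p - 1) =
    \sum_(d <- divisors ((p - 1) %/ m)) d * totient ((p - 1) %/ d).
Proof.
have p_gt1 := prime_gt1 p_prime.
have n_gt0 : 0 < p - 1 by rewrite subn_gt0.
have Fp_pred : #|'F_p|.-1 = p - 1 by rewrite card_Fp // subn1.
case: e e_ge1 => // k _; pose b : nat := c k.
have c_k : (c k = b%:R)%R by rewrite natr_Zp.
have c_0 : (c 0%N = b%:R)%R.
  apply: ord_inj; rewrite val_Zp_nat; first exact: padic_res_mod.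
  by rewrite expn1.
have b_prim := padic_order_primitive p_prime c_0 m_order.
have b_neq0 : (b%:R != 0 :> 'F_p)%R.
  have m_gt0 := prim_order_gt0 b_prim; apply/eqP => b0.
  have /eqP := prim_expr_order b_prim.
  by rewrite b0 GRing.expr0n gtn_eqF // eq_sym GRing.oner_eq0.
have m_dvd : m %| p - 1.
  by rewrite (prim_order_dvd b_prim) -Fp_pred expf_card_pred.
split; last by apply: sum_gcdn_dvd; rewrite ?dvdn_div.
transitivity #|[set x : 'I_(p ^ k.+1 * (p - 1)) |
    ~~ (p %| x) && (x ^ x == b %[mod p ^ k.+1])]|.
  (* Neither x = 0 nor x = p ^ e * (p - 1) is a solution, both being multiples
     of p, so that the range of x may be shifted by one. *)
  set N := p ^ k.+1 * (p - 1).
  have widen_inj : injective (widen_ord (leqnSn N)).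
    by move=> x y /(congr1 val) /= eq_xy; apply: val_inj.
  rewrite -[RHS](card_imset _ widen_inj).
  apply: eq_card => x; apply/idP/imsetP => [|[y]]; rewrite !inE.
    case/and3P=> x_gt0 npx /asboolP.
    rewrite -GRing.natrX => /(padic_eqmod_nat p_gt1 _ c_k)/eqP xb.
    have ltx : x < N.
      rewrite ltn_neqAle -ltnS ltn_ord andbT; apply: contraNneq npx => ->.
      by rewrite /N expnS -mulnA dvdn_mulr.
    by exists (Ordinal ltx); [rewrite inE npx xb | apply: val_inj].
  case/andP=> npy /eqP yb ->; rewrite /= npy lt0n.
  have -> /= : val y != 0 by apply: contraNneq npy => ->; rewrite dvdn0.
  by apply/asboolP; rewrite -GRing.natrX; apply/(padic_eqmod_nat p_gt1 _ c_k).
rewrite card_selfpower_lift // card_selfpower_modp // big_mkord.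
rewrite [RHS]big_mkcond; apply: eq_bigr => x0 _.
rewrite card_expf_fiber // Fp_pred -(prim_order_dvd b_prim).
(* Both conditions say that m * gcd(x0, p - 1) divides p - 1. *)
by rewrite dvdn_divRL ?dvdn_gcdr // mulnC -dvdn_divRL.
Qed.
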